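(* Let $(U_n)_{n\ge 0}$ be the negative but linearly reinforced urn scheme with $k$ colours, parameter $\theta\ge 1$, stochastic replacement matrix $R$ and initial configuration $U_0$, and suppose that $\hat R=\frac{1}{k\theta-1}(\theta J_k-R)$ is irreducible. Then, for every starting configuration $U_0$ (a probability vector), $$\frac{U_{n,j}}{n+1}\longrightarrow \mu_j\quad\text{a.s. for all } 0\le j\le k-1,$$ where $\mu=(\mu_0,\mu_1,\dots,\mu_{k-1})$ is the unique solution of the matrix equation $$(\theta\mathbf 1-\mu)R=(k\theta-1)\mu .$$
   Context: Model. Let $k\ge 2$ be an integer, $S=\{0,1,\dots,k-1\}$ the set of colours, $\theta\ge 1$ a real parameter, $R=((R_{i,j}))_{0\le i,j\le k-1}$ a stochastic matrix (nonnegative entries, all row sums equal to $1$), and $U_0=(U_{0,j})_{0\le j\le k-1}$ a (deterministic) probability vector on $S$. The negative but linearly reinforced urn scheme with initial configuration $U_0$ and replacement matrix $R$ is the process $(U_n)_{n\ge0}$ of random row vectors in $[0,\infty)^k$ defined recursively as follows. With $\mathcal F_n=\sigma(U_0,\dots,U_n)$, the random colour $Z_n\in S$ (the colour chosen at draw $n+1$) satisfies $$\mathbb P(Z_n=j\mid\mathcal F_n)=\frac{1}{k\theta-1}\left(\theta-\frac{U_{n,j}}{n+1}\right),\quad 0\le j\le k-1,$$ and $U_{n+1}=U_n+\chi_{n+1}R$, where $\chi_{n+1}=(\mathbf 1(Z_n=j))_{0\le j\le k-1}$ is a row vector. (Then $\sum_j U_{n,j}=n+1$ for all $n$.) Notation.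 $\mathbf 1$ denotes the row vector of length $k$ with all entries $1$, $J_k$ the $k\times k$ matrix with all entries $1$. The matrix $\hat R=\frac{1}{k\theta-1}(\theta J_k-R)$ is stochastic, and irreducibility is meant in the Markov chain sense. *)

(* Defs.v *)
From HB Require Import structures.
From mathcomp Require Export all_boot all_order all_algebra.
From mathcomp Require Export all_classical all_reals all_analysis.
Export Order.TTheory GRing.Theory Num.Theory.
Export numFieldNormedType.Exports.

Set Implicit Arguments.
Unset Strict Implicit.
Unset Printing Implicit Defensive.

Local Open Scope classical_set_scope.
Local Open Scope ring_scope.

Definition prob_vector (R : realType) (k : nat) (u : 'rV[R]_k) : Prop :=
  (forall j, 0 <= u 0 j) /\ \sum_j u 0 j = 1.

Definition stochastic_mx (R : realType) (k : nat) (A : 'M[R]_k) : Prop :=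
  (forall i j, 0 <= A i j) /\ forall i, \sum_j A i j = 1.

Definition irreducible_mx (R : realType) (k : nat) (A : 'M[R]_k) : Prop :=
  forall i j, exists n : nat, 0 < (A ^+ n) i j.

(* [const_mx 1] is J_k here and the all-ones row vector in [urn_eq]. *)
Definition hat_mx (R : realType) (k : nat) (theta : R) (A : 'M[R]_k) : 'M[R]_k :=
  (k%:R * theta - 1)^-1 *: (theta *: const_mx 1 - A).

Definition urn_eq (R : realType) (k : nat) (theta : R) (A : 'M[R]_k)
    (mu : 'rV[R]_k) : Prop :=
  (theta *: const_mx 1 - mu) *m A = (k%:R * theta - 1) *: mu.

(* sigma(U_0, ..., U_n); the sigma-algebra of a random vector is the one
   generated by its coordinates. *)
Definition natural_filtration (R : realType) (k : nat) (T : Type)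
    (U : nat -> T -> 'rV[R]_k) (n : nat) : set (set T) :=
  <<s [set B : set T | exists (m : nat) (j : 'I_k), (m <= n)%N /\
        preimage_set_system setT (fun w => U m w 0 j)
          (measurable : set (set R)) B] >>.

(* [Y] is a version of the conditional probability P(E | F), where [F] is a
   sub-sigma-algebra of the measurable sets of [T]. *)
Definition is_cond_prob d (T : measurableType d) (R : realType)
    (P : probability T R) (F : set (set T)) (E : set T) (Y : T -> R) : Prop :=
  [/\ forall B : set R, measurable B -> F (Y @^-1` B),
      P.-integrable setT (EFin \o Y)
    & forall A : set T, F A -> P (A `&` E) = (\int[P]_(w in A) (Y w)%:E)%E].

(* [Z n] is the colour of draw n + 1; the indicator row vector chi_(n+1) is
   [delta_mx 0 (Z n w)]. *)
Record neg_urn_scheme d (T : measurableType d) (R : realType)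
    (P : probability T R) (k : nat) (theta : R) (A : 'M[R]_k) (u0 : 'rV[R]_k)
    (U : nat -> T -> 'rV[R]_k) (Z : nat -> T -> 'I_k) : Prop := NegUrnScheme {
  urn_measurable : forall n j, measurable_fun setT (fun w => U n w 0 j);
  urn_colour_measurable : forall n j, measurable [set w | Z n w = j];
  urn_init : forall w, U 0%N w = u0;
  urn_colour_law : forall n j,
    is_cond_prob P (natural_filtration U n) [set w | Z n w = j]
      (fun w => (k%:R * theta - 1)^-1 * (theta - U n w 0 j / n.+1%:R));
  urn_step : forall n w, U n.+1 w = U n w + delta_mx 0 (Z n w) *m A
}.

(* Main.v *)
Require Import Defs.
From mathcomp Require Import measurable_realfun ring lra.
Set Implicit Arguments.
Unset Strict Implicit.
Unset Printing Implicit Defensive.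
Local Open Scope classical_set_scope.
Local Open Scope ring_scope.

(** Write c = k theta - 1, V_n = U_n / (n+1), W_n = V_n - mu and
    S_n = W_0 + ... + W_(n-1).  The conditional mean of the increment of U at
    time n is the drift c^-1 (theta 1 - V_n) A, which equals
    mu - c^-1 W_n A because mu solves the matrix equation.  Summing the
    increments gives the exact identity
      (n+1) W_n = (U_0 - mu + N_n) - c^-1 S_n A,
    where N_n is the sum of the martingale noise, and the proof has two
    independent halves.

    Deterministic half.  Adding (n+1) S_n to both sides yields
      (n+1) S_(n+1) = S_n ((n+1) I - c^-1 A) + (U_0 - mu + N_n).
    On row vectors of total mass zero the operator m I - c^-1 A has l1 norm at
    most m + rho for one rho < 1 and every m >= 1 ([replacement_contraction]).
    If c > 1 this is the contractivity of a stochastic matrix, with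
    rho = 1 / c.  Since c >= 1, the only other case is k = 2 and theta = 1,
    where A acts on mass-zero vectors as a scalar lambda in [-1, 1]; the value
    lambda = -1 means that A swaps the colours, and then [hat_mx 1 A] is
    the identity, which is not irreducible.  Hence x_n = |S_n| / (n+1)
    satisfies
      x_(n+1) <= (1 - (1 - rho) / (n+2)) x_n + eta_n / (n+2)
    with eta_n = |U_0 - mu + N_n| / (n+1).  If N_n / n tends to 0, so does
    eta_n, and then x_n tends to 0 because the harmonic series diverges
    ([damped_cvg0]); the identity above gives W_n --> 0 ([urn_path_cvg]).  The
    same contraction makes c I + A invertible, which is the existence and
    uniqueness of mu ([urn_eq_unit]).

    Probabilistic half.  The noise increments are bounded and orthogonal to
    every power of the current noise sum ([noise_orthogonal]), so
    E N_n^4 = O(n^2), the sum of the E (N_n / (n+1))^4 is finite, and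
    N_n / (n+1) tends to 0 almost surely ([martingale_strong_law]).  Only
    simple functions occur, because after n draws the urn has at most k^n
    possible histories; conditional expectations therefore reduce to finite
    sums over level sets. *)

(** * Damped recursions *)

Lemma harmonic_homo (R : realType) :
  {homo series (@harmonic R) : m n / (m <= n)%N >-> m <= n}.
Proof.
apply/nondecreasing_seqP => n; rewrite /series/= big_nat_recr//= lerDl.
by rewrite invr_ge0.
Qed.

Lemma harmonic_unbounded (R : realType) (M : R) :
  exists n, M <= series (@harmonic R) n.
Proof.
apply: contrapT => h; apply: (@dvg_harmonic R).
apply: nondecreasing_is_cvgn; first exact: harmonic_homo.
exists M => _ [n _ <-].
rewrite leNgt; apply/negP => Mn; apply: h; exists n.+1.
by apply: (le_trans (ltW Mn)); exact: harmonic_homo.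
Qed.

(** The product of the factors 1 - kap / (m+2) tends to 0: it is at most the
    inverse of 1 + kap (H_(n+1) - H_(n0+1)), H being the harmonic series, as
    (1 - t) (1 + h + t) <= 1 + h for h, t >= 0. *)
Lemma damped_le_harmonic (R : realType) (x : R ^nat) (kap : R) n0 :
  0 < kap <= 1 -> (forall n, 0 <= x n) ->
  (forall n, (n0 <= n)%N -> x n.+1 <= (1 - kap / n.+2%:R) * x n) ->
  forall n, (n0 <= n)%N ->
    x n * (1 + kap * (series harmonic n.+1 - series harmonic n0.+1)) <= x n0.
Proof.
move=> /andP[kap0 kap1] x0 xS n /subnK <-; elim: (n - n0)%N => [|{}n IH].
  by rewrite add0n subrr mulr0 addr0 mulr1.
rewrite addSn; set y := (n + n0)%N in IH *.
have n0y : (n0 <= y)%N by rewrite leq_addl.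
have H0 : 0 <= series harmonic y.+1 - series (@harmonic R) n0.+1.
  by rewrite subr_ge0 harmonic_homo.
apply: le_trans IH; set z : R := y.+2%:R^-1.
have z0 : 0 <= kap * z by rewrite mulr_ge0 ?invr_ge0// ltW.
have := xS y n0y; rewrite -/z.
have -> : series harmonic y.+2 - series (@harmonic R) n0.+1 =
    series harmonic y.+1 - series (@harmonic R) n0.+1 + z.
  by rewrite addrAC {1}/series/= big_nat_recr.
set H := _ - _ in H0 *; rewrite (mulrDr kap).
have : 0 <= kap * H by rewrite mulr_ge0// ltW.
have := x0 y; move: (x y) (x y.+1) (kap * H) (kap * z) z0.
move=> a b h t t0 a0 h0 ba.
have k0 : 0 <= 1 + (h + t) by lra.
apply: (le_trans (ler_wpM2r k0 ba)).
have : 0 <= a * (h * t + t * t).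
  by rewrite mulr_ge0// addr_ge0// mulr_ge0.
lra.
Qed.

(** Above any level d > 0 the perturbation is eventually absorbed, eta n <= kap d,
    so the excess of x over d obeys the unperturbed recursion and vanishes. *)
Lemma damped_cvg0 (R : realType) (x eta : R ^nat) (kap : R) :
  0 < kap <= 1 -> (forall n, 0 <= x n) -> eta @ \oo --> 0 ->
  (forall n, x n.+1 <= (1 - kap / n.+2%:R) * x n + eta n / n.+2%:R) ->
  x @ \oo --> 0.
Proof.
move=> kap01 x0 eta0 xS; have /andP[kap0 kap1] := kap01.
apply/cvgr0Pnorm_le => e e0.
have d0 : 0 < e / 2 by rewrite divr_gt0.
have ked0 : 0 < kap * (e / 2) by rewrite mulr_gt0.
move/cvgr0Pnorm_le : eta0 => /(_ _ ked0)[n0 _ etan0].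
pose y n := Num.max (x n - e / 2) 0.
have y0 n : 0 <= y n by rewrite le_max lexx orbT.
have yS n : (n0 <= n)%N -> y n.+1 <= (1 - kap / n.+2%:R) * y n.
  move=> n0n; have nn2 : (0 : R) < n.+2%:R^-1 by rewrite invr_gt0.
  have kn : 0 <= 1 - kap / n.+2%:R.
    by rewrite subr_ge0 ler_pdivrMr// mul1r (le_trans kap1)// ler1n.
  rewrite ge_max mulr_ge0// andbT.
  apply: (@le_trans _ _ ((1 - kap / n.+2%:R) * (x n - e / 2))); last first.
    by rewrite ler_wpM2l// le_max lexx.
  have := xS n; have /(le_trans (ler_norm _)) := etan0 _ n0n.
  move=> /(ler_wpM2r (ltW nn2)); move: (n.+2%:R^-1) (e / 2) => m d; lra.
(* Once the harmonic series has grown by (y n0 / (e / 2)) / kap, the product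
   bound forces y n <= e / 2. *)
have [N HN] := harmonic_unbounded
  (series harmonic n0.+1 + (y n0 / (e / 2)) / kap).
near=> n; rewrite ger0_norm//.
have n0n : (n0 <= n)%N by near: n; exists n0.
have := damped_le_harmonic kap01 y0 yS n0n.
have : y n0 / (e / 2) / kap <= series harmonic n.+1 - series harmonic n0.+1.
  rewrite lerBrDl; apply: le_trans HN _.
  apply: harmonic_homo.
  by near: n; exists N => // m /=; exact: leqW.
rewrite !ler_pdivrMr//; set D := _ - _ => h1 h2.
have D0 : 0 <= D by rewrite subr_ge0 harmonic_homo.
have yn : y n <= e / 2.
  rewrite leNgt; apply/negP => yn.
  have K0 : 0 <= kap * D by rewrite mulr_ge0// ltW.
  have := ler_wpM2r K0 (ltW yn).
  have := lt_le_trans d0 (ltW yn).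
  move: h1 h2; lra.
have : x n - e / 2 <= y n by rewrite le_max lexx.
lra.
Unshelve. all: by end_near. Qed.

(** * The replacement operator in l1 norm *)

(** On row vectors this is the norm for which right multiplication by a
    stochastic matrix is a contraction. *)
Definition l1 (R : realType) (k : nat) (v : 'rV[R]_k) : R := \sum_j `|v 0 j|.

Section L1.
Variables (R : realType) (k : nat).
Implicit Types (v w : 'rV[R]_k) (A : 'M[R]_k).

Lemma l1_ge0 v : 0 <= l1 v.
Proof. exact: sumr_ge0. Qed.

Lemma ler_l1D v w : l1 (v + w) <= l1 v + l1 w.
Proof.
by rewrite /l1 -big_split; apply: ler_sum => j _; rewrite mxE ler_normD.
Qed.

Lemma l1Z a v : l1 (a *: v) = `|a| * l1 v.
Proof. by rewrite /l1 mulr_sumr; apply: eq_bigr => j _; rewrite mxE normrM. Qed.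

Lemma l1N v : l1 (- v) = l1 v.
Proof. by rewrite -scaleN1r l1Z normrN1 mul1r. Qed.

Lemma l1_le0_eq0 v : l1 v <= 0 -> v = 0.
Proof.
move=> v0; apply/rowP => j; rewrite mxE; apply/eqP; rewrite -normr_le0.
by apply: le_trans v0; rewrite /l1 (bigD1 j)//= lerDl sumr_ge0.
Qed.

Lemma sum_mul_stochastic A v : stochastic_mx A ->
  \sum_j (v *m A) 0 j = \sum_j v 0 j.
Proof.
move=> [_ A1]; under eq_bigr do rewrite mxE.
by rewrite exchange_big/=; apply: eq_bigr => i _; rewrite -mulr_sumr A1 mulr1.
Qed.

Lemma l1_mul_stochastic A v : stochastic_mx A -> l1 (v *m A) <= l1 v.
Proof.
move=> [A0 A1]; rewrite /l1.
have -> : \sum_j `|v 0 j| = \sum_j \sum_i `|v 0 i| * A i j.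
  rewrite exchange_big/=; apply: eq_bigr => i _.
  by rewrite -mulr_sumr A1 mulr1.
apply: ler_sum => j _; rewrite mxE; apply: le_trans (ler_norm_sum _ _ _) _.
by apply: ler_sum => i _; rewrite normrM (ger0_norm (A0 _ _)).
Qed.

End L1.

Lemma ord2_ind (P : 'I_2 -> Prop) : P 0 -> P 1 -> forall i, P i.
Proof.
by move=> P0 P1 [[|[|//]] i]; [move: P0 | move: P1]; congr P; exact/val_inj.
Qed.

Lemma big_ord2 (R : realType) (F : 'I_2 -> R) : \sum_i F i = F 0 + F 1.
Proof.
by rewrite big_ord_recl big_ord1; congr (_ + F _); exact/val_inj.
Qed.

(** Mass-zero vectors form a line when there are two colours, and a stochastic
    matrix preserves mass; the scalar is its second eigenvalue. *)
Lemma zero_sum_eigen2 (R : realType) (A : 'M[R]_2) (v : 'rV[R]_2) :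
  stochastic_mx A -> \sum_j v 0 j = 0 -> v *m A = (A 0 0 - A 1 0) *: v.
Proof.
move=> [_ A1]; rewrite big_ord2 addrC => /eqP; rewrite addr_eq0 => /eqP v1.
have := A1 0; have := A1 1; rewrite !big_ord2 => A11 A01.
have -> : A 0 0 - A 1 0 = A 1 1 - A 0 1 by lra.
apply/rowP; apply: ord2_ind; rewrite !mxE big_ord2 v1; last by ring.
have -> : A 1 1 - A 0 1 = A 0 0 - A 1 0 by lra.
ring.
Qed.

(** Equality would force the matrix to swap the two colours; the matrix
    [hat_mx 1 A] is then the identity and cannot lead from colour 0 to
    colour 1. *)
Lemma irreducible_eigen2 (R : realType) (A : 'M[R]_2) :
  stochastic_mx A -> irreducible_mx (hat_mx 1 A) -> A 1 0 - A 0 0 < 1.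
Proof.
move=> [A0 A1] irr; rewrite ltNge; apply/negP => le1.
have := A1 0; have := A1 1; rewrite !big_ord2 => A11 A01.
have p00 := A0 0 0; have p01 := A0 0 1; have p10 := A0 1 0; have p11 := A0 1 1.
have A_00 : A 0 0 = 0 by lra.
have A_01 : A 0 1 = 1 by lra.
have A_10 : A 1 0 = 1 by lra.
have A_11 : A 1 1 = 0 by lra.
have h1 : hat_mx 1 A = 1%:M.
  rewrite /hat_mx mulr1 (_ : 2%:R - 1 = 1); last by ring.
  rewrite invr1 !scale1r; apply/matrixP.
  by apply: ord2_ind; apply: ord2_ind; rewrite !mxE/= ?A_00 ?A_01 ?A_10 ?A_11
    ?subr0 ?subrr.
by have [n] := irr 0 1; rewrite h1 expr1n mxE ltxx.
Qed.

Lemma urn_scale_ge1 (R : realType) (k : nat) (theta : R) :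
  (2 <= k)%N -> 1 <= theta -> 1 <= k%:R * theta - 1.
Proof.
rewrite -(ler_nat R) => k2 theta1; rewrite lerBrDr; apply: (le_trans k2).
by rewrite -[leLHS]mulr1 ler_wpM2l.
Qed.

(** The one place where irreducibility enters.  The bound is stated for all
    m >= 1 at once, rather than as a spectral gap, since it is applied with
    m = n + 1 in the recursion for the partial sums and with m = 1 for the
    invertibility of c I + A. *)
Lemma replacement_contraction (R : realType) (k : nat) (theta : R) (A : 'M[R]_k) :
  (2 <= k)%N -> 1 <= theta -> stochastic_mx A ->
  irreducible_mx (hat_mx theta A) ->
  exists2 rho : R, 0 <= rho < 1 &
    forall (v : 'rV[R]_k) (m : R), \sum_j v 0 j = 0 -> 1 <= m ->
      l1 (m *: v - (k%:R * theta - 1)^-1 *: (v *m A)) <= (m + rho) * l1 v.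
Proof.
move=> hk htheta hA hirr; set c := k%:R * theta - 1.
have c1 : 1 <= c by exact: urn_scale_ge1.
move: c1; rewrite le_eqVlt => /predU1P[c1|c1].
  (* c = 1 leaves only k = 2 and theta = 1, since c >= k - 1. *)
  have k_eq2 : k = 2%N.
    apply/eqP; rewrite eqn_leq hk andbT -(ler_nat R).
    have : k%:R * 1 <= k%:R * theta by rewrite ler_wpM2l.
    rewrite mulr1; move: c1; rewrite /c; lra.
  have theta1 : theta = 1 by move: c1; rewrite /c k_eq2; lra.
  rewrite -c1 invr1; subst k theta => {c c1 htheta hk}.
  have la1 := irreducible_eigen2 hA hirr.
  exists (Num.max 0 (A 1 0 - A 0 0)); first by rewrite le_max lexx gt_max ltr01.
  move=> v m v0 m1; rewrite zero_sum_eigen2// scale1r -scalerBl l1Z.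
  apply: ler_wpM2r; first exact: l1_ge0.
  have A00 : A 0 0 <= 1.
    by case: hA => A0 /(_ 0) <-; rewrite (bigD1 0)//= lerDl sumr_ge0.
  have A10 : 0 <= A 1 0 by case: hA.
  rewrite ger0_norm; last lra.
  by rewrite opprB lerD2l le_max lexx orbT.
(* For c > 1 contractivity of A alone suffices. *)
exists c^-1.
  by rewrite invr_ge0 (le_trans ler01 (ltW c1))/= invf_lt1// (lt_trans ltr01).
move=> v m _ m1; apply: le_trans (ler_l1D _ _) _.
rewrite l1N !l1Z mulrDl !ger0_norm ?invr_ge0 ?(le_trans ler01 (ltW c1)) ?(le_trans ler01 m1)//.
rewrite lerD2l ler_wpM2l ?l1_mul_stochastic//.
by rewrite invr_ge0 (le_trans ler01 (ltW c1)).
Qed.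

Lemma urn_eq_mulmx (R : realType) (k : nat) (theta : R) (A : 'M[R]_k) (mu : 'rV[R]_k) :
  urn_eq theta A mu <->
  mu *m ((k%:R * theta - 1)%:M + A) = (theta *: const_mx 1) *m A.
Proof.
rewrite /urn_eq mulmxBl mulmxDr mul_mx_scalar; split => [<-|<-]; first by rewrite subrK.
by rewrite addrK.
Qed.

(** A vector killed by c I + A has mass zero, as A preserves mass and c + 1 > 0.
    For such v the vector v - c^-1 v A is 2 v, which the contraction with m = 1
    bounds by (1 + rho) |v| with rho < 1. *)
Lemma urn_eq_unit (R : realType) (k : nat) (theta : R) (A : 'M[R]_k) :
  (2 <= k)%N -> 1 <= theta -> stochastic_mx A ->
  irreducible_mx (hat_mx theta A) ->
  (k%:R * theta - 1)%:M + A \in unitmx.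
Proof.
move=> hk htheta hA hirr.
have [rho /andP[rho0 rho1] contr] := replacement_contraction hk htheta hA hirr.
set c := k%:R * theta - 1 in contr *.
have c1 : 1 <= c by exact: urn_scale_ge1.
have c0 : 0 < c by exact: lt_le_trans c1.
rewrite -row_free_unit; apply: inj_row_free => v.
rewrite mulmxDr mul_mx_scalar => /eqP; rewrite addrC addr_eq0 => /eqP vA.
have v0 : \sum_j v 0 j = 0.
  have := sum_mul_stochastic v hA; rewrite vA.
  under eq_bigr do rewrite !mxE.
  rewrite sumrN -mulr_sumr => /eqP; rewrite eq_sym -subr_eq0 opprK -{1}(mul1r (\sum_j _)) -mulrDl.
  by rewrite mulf_eq0 (gt_eqF (addr_gt0 ltr01 c0)) => /eqP.
apply: l1_le0_eq0; have := contr v 1 v0 (lexx _).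
rewrite vA scalerN opprK scalerA mulVf ?gt_eqF// !scale1r -mulr2n.
rewrite -scaler_nat l1Z ger0_norm// => h.
rewrite leNgt; apply/negP => l0.
by move: h; rewrite ler_pM2r//; move: rho1; clear; lra.
Qed.

(** * Convergence along a path with negligible noise *)

Lemma urn_eq_sum1 (R : realType) (k : nat) (theta : R) (A : 'M[R]_k) (mu : 'rV[R]_k) :
  0 < k%:R * theta -> stochastic_mx A -> urn_eq theta A mu ->
  \sum_j mu 0 j = 1.
Proof.
move=> c0 hA hmu.
have := sum_mul_stochastic (theta *: const_mx 1 - mu) hA; rewrite hmu.
under eq_bigr do rewrite mxE.
under [RHS]eq_bigr do rewrite !mxE mulr1.
rewrite -mulr_sumr sumrB sumr_const card_ord -[theta *+ k]mulr_natl.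
move: (\sum_j mu 0 j) (k%:R * theta) c0 => s K K0 h.
by apply: (mulfI (lt0r_neq0 K0)); lra.
Qed.

(** The deterministic half of the proof: pathwise, the only thing needed from
    probability is that the accumulated noise, namely U n minus its starting
    point and its accumulated drift, is o(n). *)
Lemma urn_path_cvg (R : realType) (k : nat) (theta : R) (A : 'M[R]_k)
    (mu : 'rV[R]_k) (U : nat -> 'rV[R]_k) :
  (2 <= k)%N -> 1 <= theta -> stochastic_mx A ->
  irreducible_mx (hat_mx theta A) -> urn_eq theta A mu ->
  (forall n, \sum_j U n 0 j = n.+1%:R) ->
  let drift n := (k%:R * theta - 1)^-1 *:
    ((theta *: const_mx 1 - n.+1%:R^-1 *: U n) *m A) in
  (forall j, (fun n => (U n - U 0%N - \sum_(m < n) drift m) 0 j / n.+1%:R)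
    @ \oo --> 0) ->
  forall j, (fun n => U n 0 j / n.+1%:R) @ \oo --> mu 0 j.
Proof.
move=> hk htheta hA hirr hmu sumU drift noise0 j.
have [rho /andP[rho0 rho1] contr] := replacement_contraction hk htheta hA hirr.
have c0 : 0 < k%:R * theta - 1.
  by rewrite (lt_le_trans ltr01)// urn_scale_ge1.
set c := k%:R * theta - 1 in drift noise0 contr c0 *.
have summu : \sum_j mu 0 j = 1.
  apply: urn_eq_sum1 hA hmu; move: c0; rewrite /c; lra.
pose N n := U n - U 0%N - \sum_(m < n) drift m.
pose W n := n.+1%:R^-1 *: U n - mu.
pose S n := \sum_(m < n) W m.
pose e n := U 0%N - mu + N n.
pose eta n := l1 (e n) / n.+1%:R.
have sumW n : \sum_j W n 0 j = 0.
  under eq_bigr do rewrite !mxE.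
  by rewrite sumrB -mulr_sumr sumU summu mulVf ?subrr.
have sumS n : \sum_j S n 0 j = 0.
  under eq_bigr do rewrite summxE.
  by rewrite exchange_big/=; apply: big1 => i _; exact: sumW.
(* Here mu enters as the equilibrium: the drift at V_n = mu is mu itself. *)
have driftE n : drift n = mu - c^-1 *: (W n *m A).
  rewrite /drift /W -[_ - _ *: U n](subrKA mu) mulmxDl scalerDr hmu scalerA.
  rewrite mulVf ?gt_eqF// scale1r; congr (_ + _).
  by rewrite -opprB mulNmx scalerN.
have WE n : n.+1%:R *: W n = e n - c^-1 *: (S n *m A).
  have UE : U n = N n + U 0%N + \sum_(m < n) drift m by rewrite /N addrAC !subrK.
  rewrite scalerBr scalerA divff// scale1r UE.
  under eq_bigr do rewrite driftE.
  rewrite sumrB sumr_const card_ord -scaler_sumr -mulmx_suml -/(S n) /e.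
  rewrite (_ : n.+1%:R *: mu = mu *+ n + mu); last by rewrite scaler_nat mulrSr.
  move: (mu *+ n) (c^-1 *: _) (N n) => a b f; apply/rowP => i; rewrite !mxE; ring.
have n0 n : (0 : R) < n.+1%:R by rewrite ltr0n.
have eta0 : eta @ \oo --> 0.
  rewrite (_ : eta = fun n => \sum_j `|(U 0%N - mu) 0 j / n.+1%:R + N n 0 j / n.+1%:R|).
    rewrite [X in _ --> X](_ : 0 = \sum_(j < k) (0 : R)); last by rewrite big1.
    apply: (@cvg_big _ _ +%R) => [|i _]; first exact: add_continuous.
    rewrite -(@normr0 _ R); apply: cvg_norm.
    rewrite -[X in _ --> X]addr0; apply: cvgD; last exact: noise0.
    rewrite -[X in _ --> X](mulr0 ((U 0%N - mu) 0 i)).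
    by apply: cvgMl_tmp; exact: cvg_harmonic.
  apply/funext => n; rewrite /eta /l1 mulr_suml; apply: eq_bigr => i _.
  rewrite -mulrDl normrM normfV (@ger0_norm _ n.+1%:R)//; congr (`|_| / _).
  by rewrite mxE.
have x0 : (fun n => l1 (S n) / n.+1%:R) @ \oo --> 0.
  apply: (@damped_cvg0 _ _ eta (1 - rho)) => //.
  - lra.
  - by move=> n; rewrite divr_ge0// l1_ge0.
  - move=> n; set x := l1 (S n) / n.+1%:R.
    have xE : l1 (S n) = x * n.+1%:R by rewrite /x divfK.
    have n2 : (n.+2%:R : R) = n.+1%:R + 1 by rewrite -(natrD _ _ 1) addn1.
    have : l1 (S n.+1) <= (n.+1%:R + rho) * x + eta n.
      rewrite -(ler_pM2l (n0 n)) -[X in X * l1 _]ger0_norm// -l1Z.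
      have -> : n.+1%:R *: S n.+1 =
          (n.+1%:R *: S n - c^-1 *: (S n *m A)) + e n.
        by rewrite /S big_ord_recr/= -/(S n) scalerDr WE addrA addrAC.
      apply: le_trans (ler_l1D _ _) _; rewrite mulrDr.
      apply: lerD; last by rewrite /eta mulrCA divff// mulr1.
      rewrite mulrCA mulrC (mulrC n.+1%:R) -xE mulrC; apply: contr => //.
      by rewrite ler1n.
    rewrite ler_pdivrMr// => /le_trans; apply.
    have : n.+2%:R != 0 :> R by rewrite pnatr_eq0.
    move: n2; move: (n.+2%:R) => m -> m0.
    rewrite [leRHS](_ : _ = (n.+1%:R + 1 - (1 - rho)) * x + eta n); last by field.
    by rewrite lerD2r; lra.
have W0 : (fun n => l1 (W n)) @ \oo --> 0.
  apply: (@squeeze_cvgr _ _ _ _ (cst 0) (fun n => eta n + c^-1 * (l1 (S n) / n.+1%:R))).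
  - apply: nearW => n; rewrite l1_ge0/=.
    rewrite -(ler_pM2l (n0 n)) -[X in X * l1 _]ger0_norm// -l1Z WE.
    apply: le_trans (ler_l1D _ _) _.
    rewrite l1N l1Z ger0_norm ?invr_ge0 ?(ltW c0)// mulrDr.
    rewrite /eta mulrCA divff// mulr1 lerD2l mulrCA (mulrCA n.+1%:R) divff// mulr1.
    by rewrite ler_wpM2l ?invr_ge0 ?(ltW c0)// l1_mul_stochastic.
  - exact: cvg_cst.
  - rewrite -[X in _ --> X]addr0 -[X in _ --> _ + X](mulr0 c^-1).
    by apply: cvgD => //; exact: cvgMl_tmp.
apply/cvgrPdist_le => eps eps0.
move/cvgr0Pnorm_le : W0 => /(_ _ eps0); apply: filterS => n.
rewrite ger0_norm ?l1_ge0// => /(le_trans _); apply.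
rewrite /l1 (bigD1 j)//= !mxE distrC mulrC lerDl.
exact: sumr_ge0.
Qed.

(** * Integrals of simple functions *)

Section SimpleFunctions.
Context d (T : measurableType d) (R : realType).
Implicit Types f g : T -> R.

Lemma mem_sfunP f :
  f \in sfun <-> measurable_fun setT f /\ finite_set (range f).
Proof.
split=> [/andP[/set_mem ? /set_mem ?]//|[? ?]].
by apply/andP; split; exact: mem_set.
Qed.

Lemma mem_sfun_cst (r : R) : (fun _ : T => r) \in sfun.
Proof. by apply/mem_sfunP; split=> //; exact/finite_image_cst. Qed.

Lemma mem_sfun_indic (A : set T) : measurable A -> (\1_A : T -> R) \in sfun.
Proof.
move=> mA; apply/mem_sfunP; split; first exact: measurable_indic.
by apply: sub_finite_set (@image_indic_sub _ _ _ _) _; exact: finite_set2.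
Qed.

Lemma mem_sfunD f g : f \in sfun -> g \in sfun ->
  (fun w => f w + g w) \in sfun.
Proof. exact: rpredD. Qed.

Lemma mem_sfunB f g : f \in sfun -> g \in sfun ->
  (fun w => f w - g w) \in sfun.
Proof. exact: rpredB. Qed.

Lemma mem_sfunM f g : f \in sfun -> g \in sfun ->
  (fun w => f w * g w) \in sfun.
Proof. exact: rpredM. Qed.

Lemma mem_sfunX f n : f \in sfun -> (fun w => f w ^+ n) \in sfun.
Proof.
move=> hf; elim: n => [|n IH]; first exact: mem_sfun_cst.
by under eq_fun do rewrite exprS; exact: mem_sfunM.
Qed.

Lemma mem_sfun_sum (I : Type) (s : seq I) (F : I -> T -> R) :
  (forall i, F i \in sfun) -> (fun w => \sum_(i <- s) F i w) \in sfun.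
Proof.
move=> hF; elim: s => [|i s IH].
  by under eq_fun do rewrite big_nil; exact: mem_sfun_cst.
by under eq_fun do rewrite big_cons; exact: mem_sfunD.
Qed.

End SimpleFunctions.

Section SimpleIntegral.
Context d (T : measurableType d) (R : realType) (P : probability T R).
Implicit Types f g : T -> R.

Lemma integrable_sfun f : f \in sfun -> P.-integrable setT (EFin \o f).
Proof.
move=> /mem_sfunP[mf finf]; apply: measurable_bounded_integrable => //.
  by rewrite (le_lt_trans (probability_le1 P measurableT)) ?ltry.
have [M [Mreal hM]] := compact_bounded (finite_compact finf).
by exists M; split=> // x Mx w _; apply: (hM x Mx); exists w.
Qed.

Lemma Rint_sfunD f g : f \in sfun -> g \in sfun ->
  \int[P]_w (f w + g w) = \int[P]_w f w + \int[P]_w g w.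
Proof. by move=> hf hg; rewrite RintegralD//; exact: integrable_sfun. Qed.

Lemma Rint_sfunZ f a : f \in sfun ->
  \int[P]_w (a * f w) = a * \int[P]_w f w.
Proof. by move=> hf; rewrite RintegralZl//; exact: integrable_sfun. Qed.

Lemma Rint_sfun_sum (I : Type) (s : seq I) (F : I -> T -> R) :
  (forall i, F i \in sfun) ->
  \int[P]_w (\sum_(i <- s) F i w) = \sum_(i <- s) \int[P]_w F i w.
Proof.
move=> hF; elim: s => [|i s IH].
  by under eq_Rintegral do rewrite big_nil; rewrite big_nil Rintegral_cst// mul0r.
under eq_Rintegral do rewrite big_cons.
rewrite big_cons Rint_sfunD// ?IH//.
exact: mem_sfun_sum.
Qed.

Lemma ler_Rint_sfun f g : f \in sfun -> g \in sfun -> (forall w, f w <= g w) ->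
  \int[P]_w f w <= \int[P]_w g w.
Proof. by move=> hf hg fg; apply: le_Rintegral => //; exact: integrable_sfun. Qed.

End SimpleIntegral.

(** * A strong law for bounded martingale differences *)

Lemma sum_invS_sqr_le (R : realType) n :
  \sum_(i < n) (i.+1%:R ^+ 2)^-1 <= 2 - 2 / n.+1%:R :> R.
Proof.
elim: n => [|n IH]; first by rewrite big_ord0 divr1 subrr.
rewrite big_ord_recr/=; apply: le_trans (lerD IH (lexx _)) _.
rewrite -[n.+2%:R]natr1.
have : 1 <= n.+1%:R :> R by rewrite ler1n.
move: (n.+1%:R) => m m1.
have m0 : 0 < m by lra.
have m0' : 0 < m + 1 by lra.
rewrite -subr_ge0.
rewrite (_ : _ - _ = (m - 1) / (m ^+ 2 * (m + 1))); last first.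
  by field; rewrite !lt0r_neq0.
by rewrite divr_ge0 ?subr_ge0// mulr_ge0 ?exprn_ge0 ?ltW.
Qed.

(** The sum of the Y n has finite integral, so it is finite almost everywhere,
    and the terms of a convergent series tend to 0. *)
Lemma ae_cvg0_sqr d (T : measurableType d) (R : realType) (P : probability T R)
    (Y : nat -> T -> R) (B : R) :
  (forall n, Y n \in sfun) -> (forall n w, 0 <= Y n w) ->
  (forall n, \int[P]_w Y n w <= B / n.+1%:R ^+ 2) ->
  {ae P, forall w, Y ^~ w @ \oo --> 0}.
Proof.
move=> hY Y0 IY.
have mY n : measurable_fun setT (EFin \o Y n).
  by apply/measurable_EFinP; have /mem_sfunP[] := hY n.
have B0 : 0 <= B.
  have := le_trans (Rintegral_ge0 P (fun w _ => Y0 0%N w)) (IY 0%N).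
  by rewrite expr1n divr1.
have sumI : (\sum_(n <oo) \int[P]_w (Y n w)%:E <= (2 * B)%:E)%E.
  apply: lime_le; first by apply: is_cvg_nneseries => n _ _; apply: integral_ge0 => w _; rewrite lee_fin.
  apply: nearW => n.
  rewrite (eq_bigr (fun i => (\int[P]_w Y i w)%:E)); last first.
    by move=> i _; rewrite /Rintegral fineK// integrable_fin_num//; exact: integrable_sfun.
  rewrite sumEFin lee_fin big_mkord.
  apply: (@le_trans _ _ (\sum_(i < n) B / i.+1%:R ^+ 2)).
    by apply: ler_sum => i _; exact: IY.
  rewrite -mulr_sumr mulrC ler_wpM2r//; apply: le_trans (sum_invS_sqr_le _ _) _.
  by rewrite lerBlDr lerDl divr_ge0.
pose G w := (\sum_(n <oo) (Y n w)%:E)%E.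
have G0 w : (0 <= G w)%E by apply: nneseries_ge0 => n _ _; rewrite lee_fin.
have mG : measurable_fun setT G.
  apply: (@ge0_emeasurable_sum _ _ _ _ (fun n w => (Y n w)%:E) xpredT).
    by move=> n w _ _; rewrite lee_fin.
  by move=> n _; exact: mY.
have IG : P.-integrable setT G.
  apply/integrableP; split => //.
  under eq_integral do rewrite gee0_abs//.
  rewrite integral_nneseries//; last by move=> n w _; rewrite lee_fin.
  exact: le_lt_trans sumI (ltry _).
have := integrable_ae measurableT IG; apply: filterS => w /(_ Logic.I) Gfin.
apply: cvg_series_cvg_0; apply: nondecreasing_is_cvgn.
  by apply/nondecreasing_seqP => n; rewrite /series/= big_nat_recr//= lerDl.
exists (fine (G w)) => _ [n _ <-].
rewrite -lee_fin fineK// /series/= -sumEFin.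
by apply: nneseries_lim_ge => i _ _; rewrite lee_fin.
Qed.

Section MartingaleStrongLaw.
Context d (T : measurableType d) (R : realType) (P : probability T R).
Variables (X : nat -> T -> R) (C : R).
Hypothesis X_sfun : forall n, X n \in sfun.
Hypothesis X_le : forall n w, `|X n w| <= C.
Let S n w := \sum_(i < n) X i w.
(* What is used of the martingale property: X n has zero conditional mean given
   the past, of which every power of S n is a function. *)
Hypothesis X_orth : forall n a, \int[P]_w (S n w ^+ a * X n w) = 0.

Let S_sfun n : S n \in sfun.
Proof.
elim: n => [|n IH].
  rewrite (_ : S 0 = fun=> 0); first exact: mem_sfun_cst.
  by apply/funext => w; rewrite /S big_ord0.
rewrite (_ : S n.+1 = fun w => S n w + X n w); first exact: mem_sfunD.
by apply/funext => w; rewrite /S big_ord_recr.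
Qed.

Let Rint_cst (r : R) : \int[P]_w r = r.
Proof. by rewrite Rintegral_cst// [X in fine X](@probability_setT _ _ _ P) mulr1. Qed.

Let X2_le n w : X n w ^+ 2 <= C ^+ 2.
Proof.
rewrite -real_normK ?num_real// ler_pXn2r// ?nnegrE//.
exact: le_trans (normr_ge0 _) (X_le n w).
Qed.

Lemma martingale_moment2 n : \int[P]_w (S n w ^+ 2) <= C ^+ 2 * n%:R.
Proof.
elim: n => [|n IH].
  by under eq_Rintegral do rewrite /S big_ord0 expr0n; rewrite Rint_cst mulr0.
have hS := S_sfun n.
pose g w := S n w ^+ 2 + (2 * (S n w ^+ 1 * X n w) + C ^+ 2).
have h1 : (fun w => 2 * (S n w ^+ 1 * X n w)) \in sfun.
  by do !apply: mem_sfunM => //; first exact: mem_sfun_cst; exact: mem_sfunX.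
have hC : (fun _ : T => C ^+ 2) \in sfun by exact: mem_sfun_cst.
have h2 := mem_sfunD h1 hC.
have : \int[P]_w (S n.+1 w ^+ 2) <= \int[P]_w g w.
  apply: ler_Rint_sfun; first exact: mem_sfunX.
    by apply: mem_sfunD => //; exact: mem_sfunX.
  move=> w; rewrite /g /S big_ord_recr/= -/(S n w) expr1.
  have := X2_le n w; lra.
move=> /le_trans; apply; rewrite Rint_sfunD//; last exact: mem_sfunX.
rewrite Rint_sfunD// Rint_sfunZ ?X_orth ?mulr0 ?add0r ?Rint_cst; last first.
  by apply: mem_sfunM => //; exact: mem_sfunX.
by rewrite -natr1 mulrDr mulr1 lerD2r.
Qed.

(** With fourth moments E (S n / n.+1) ^+ 4 is summable over all n, so that no
    passage to a subsequence is needed, as it would be with variances. *)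
Lemma martingale_moment4 n :
  \int[P]_w (S n w ^+ 4) <= 4 * C ^+ 4 * n%:R ^+ 2.
Proof.
elim: n => [|n IH].
  under eq_Rintegral do rewrite /S big_ord0 expr0n.
  by rewrite Rint_cst expr0n mulr0.
have hS := S_sfun n.
(* The cross term 4 s x^3 of (s + x)^4 is at most 2 s^2 x^2 + 2 x^4, which
   turns 6 s^2 x^2 into 8 s^2 x^2 and x^4 into 3 x^4. *)
pose g w := S n w ^+ 4 +
  (4 * (S n w ^+ 3 * X n w) + (8 * C ^+ 2 * S n w ^+ 2 + 3 * C ^+ 4)).
have h1 : (fun w => 4 * (S n w ^+ 3 * X n w)) \in sfun.
  by do !apply: mem_sfunM => //; first exact: mem_sfun_cst; exact: mem_sfunX.
have h2 : (fun w => 8 * C ^+ 2 * S n w ^+ 2) \in sfun.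
  by apply: mem_sfunM; [exact: mem_sfun_cst|exact: mem_sfunX].
have hC : (fun _ : T => 3 * C ^+ 4) \in sfun by exact: mem_sfun_cst.
have h3 := mem_sfunD h2 hC.
have : \int[P]_w (S n.+1 w ^+ 4) <= \int[P]_w g w.
  apply: ler_Rint_sfun; first exact: mem_sfunX.
    by apply: mem_sfunD; [exact: mem_sfunX|exact: mem_sfunD].
  move=> w; rewrite /g /S big_ord_recr/= -/(S n w).
  have := X2_le n w; move: (S n w) (X n w) => s x x2.
  have p1 : s ^+ 2 * x ^+ 2 <= s ^+ 2 * C ^+ 2 by rewrite ler_wpM2l// sqr_ge0.
  have p2 : (x ^+ 2) ^+ 2 <= (C ^+ 2) ^+ 2 by rewrite ler_pXn2r// nnegrE sqr_ge0.
  have p3 : 0 <= (s * x - x ^+ 2) ^+ 2 by rewrite sqr_ge0.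
  lra.
move=> /le_trans; apply; rewrite Rint_sfunD; [|exact: mem_sfunX|exact: mem_sfunD].
rewrite Rint_sfunD// Rint_sfunD// Rint_cst.
rewrite Rint_sfunZ ?X_orth ?mulr0 ?add0r; last first.
  by apply: mem_sfunM => //; exact: mem_sfunX.
rewrite Rint_sfunZ; last exact: mem_sfunX.
have := martingale_moment2 n.
have C20 : 0 <= 8 * C ^+ 2 by rewrite mulr_ge0// sqr_ge0.
move=> /(ler_wpM2l C20).
have : 0 <= (C ^+ 2) ^+ 2 by rewrite sqr_ge0.
rewrite -natr1.
move: IH; lra.
Qed.

Lemma martingale_strong_law :
  {ae P, forall w, (fun n => S n w / n.+1%:R) @ \oo --> 0}.
Proof.
have Yb n : \int[P]_w ((S n w / n.+1%:R) ^+ 4) <= 4 * C ^+ 4 / n.+1%:R ^+ 2.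
  under eq_Rintegral do rewrite expr_div_n mulrC.
  rewrite Rint_sfunZ; last exact: mem_sfunX.
  rewrite mulrC ler_pdivrMr ?exprn_gt0 ?ltr0n//.
  apply: le_trans (martingale_moment4 n) _.
  rewrite [leRHS](_ : _ = 4 * C ^+ 4 * n.+1%:R ^+ 2); last first.
    have : n.+1%:R != 0 :> R by rewrite pnatr_eq0.
    by move: (n.+1%:R) => m m0; field.
  apply: ler_wpM2l; first by rewrite mulr_ge0 ?exprn_even_ge0.
  by rewrite ler_pXn2r ?nnegrE// ler_nat.
have hY n : (fun w => (S n w / n.+1%:R) ^+ 4) \in sfun.
  by apply: mem_sfunX; apply: mem_sfunM => //; exact: mem_sfun_cst.
have := ae_cvg0_sqr hY (fun n w => exprn_even_ge0 (S n w / n.+1%:R) (isT : ~~ odd 4)) Yb.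
apply: filterS => w h; apply/cvgr0Pnorm_le => e e0.
have e4 : 0 < e ^+ 4 by rewrite exprn_gt0.
move/cvgr0Pnorm_le : h => /(_ _ e4); apply: filterS => n.
by rewrite normrX ler_pXn2r ?nnegrE// ltW.
Qed.

End MartingaleStrongLaw.

(** * The noise of the urn *)

Lemma Rintegral_indicM d (T : measurableType d) (R : realType)
    (P : probability T R) (B : set T) (f : T -> R) :
  \int[P]_w (\1_B w * f w) = \int[P]_(w in B) f w.
Proof.
rewrite [RHS]Rintegral_mkcond; apply: eq_Rintegral => w _.
by rewrite patchE indicE; case: (w \in B); rewrite ?mul1r ?mul0r.
Qed.

(** The defining identity of a conditional probability is this statement for
    the indicator of an event of <<s G>>; a simple Y is a finite combination of
    such indicators, those of its level sets. *)
Lemma cond_prob_orthogonal d (T : measurableType d) (R : realType)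
    (P : probability T R) (G : set (set T)) (E : set T) (p Y : T -> R) :
  <<s G>> `<=` measurable -> measurable E -> is_cond_prob P <<s G>> E p ->
  p \in sfun -> Y \in @sfun _ (g_sigma_algebraType G) R ->
  \int[P]_w (Y w * (\1_E w - p w)) = 0.
Proof.
move=> Gm mE [_ _ pE] hp /mem_sfunP[mY finY].
pose s : seq R := finmap.enum_fset (fset_set (range Y)).
have GY y : <<s G>> (Y @^-1` [set y]).
  by have := mY measurableT _ (measurable_set1 y); rewrite setTI.
have YE w : Y w = \sum_(y <- s) y * \1_(Y @^-1` [set y]) w.
  rewrite (bigD1_seq (Y w)) /=; last exact: finmap.fset_uniq.
    rewrite big1 ?addr0; first by rewrite indicE mem_set// mulr1.
    by move=> y /eqP yY; rewrite indicE memNset ?mulr0// => /= /esym.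
  by rewrite in_fset_set// mem_set//; exists w.
under eq_Rintegral do rewrite YE mulr_suml.
have hd : (fun w => \1_E w - p w) \in sfun.
  by apply: mem_sfunB => //; exact: mem_sfun_indic.
have h1 y : (fun w => \1_(Y @^-1` [set y]) w * (\1_E w - p w)) \in sfun.
  by apply: mem_sfunM => //; apply: mem_sfun_indic; exact: Gm.
rewrite Rint_sfun_sum; last first.
  move=> y; under eq_fun do rewrite -mulrA.
  by apply: mem_sfunM; [exact: mem_sfun_cst|exact: h1].
apply: big1 => y _; under eq_Rintegral do rewrite -mulrA.
rewrite Rint_sfunZ// Rintegral_indicM.
have mB := Gm _ (GY y).
rewrite RintegralB//; last 2 first.
- apply: integrableS (integrable_sfun P (mem_sfun_indic R mE)) => //.
- apply: integrableS (integrable_sfun P hp) => //.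
by rewrite /Rintegral integral_indic// -(pE _ (GY y)) setIC subrr mulr0.
Qed.

Section UrnPath.
Context d (T : measurableType d) (R : realType) (P : probability T R).
Variables (k : nat) (theta : R) (A : 'M[R]_k) (u0 : 'rV[R]_k).
Variables (U : nat -> T -> 'rV[R]_k) (Z : nat -> T -> 'I_k).
Hypotheses (hu0 : prob_vector u0) (hA : stochastic_mx A).
Hypothesis urn : neg_urn_scheme P theta A u0 U Z.

Lemma urn_stepE n w j : U n.+1 w 0 j = U n w 0 j + A (Z n w) j.
Proof. by rewrite (urn_step urn) mxE -rowE mxE. Qed.

Lemma urn_sum n w : \sum_j U n w 0 j = n.+1%:R.
Proof.
elim: n => [|n IH]; first by rewrite (urn_init urn); case: hu0.
under eq_bigr do rewrite urn_stepE.
by rewrite big_split/= IH; case: hA => _ ->; rewrite natr1.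
Qed.

Lemma urn_ge0 n w j : 0 <= U n w 0 j.
Proof.
elim: n => [|n IH]; first by rewrite (urn_init urn); case: hu0.
by rewrite urn_stepE addr_ge0//; case: hA.
Qed.

Lemma urn_le n w j : U n w 0 j <= n.+1%:R.
Proof.
rewrite -(urn_sum n w) (bigD1 j)//= lerDl; apply: sumr_ge0 => i _.
exact: urn_ge0.
Qed.

(** Generators of the natural filtration at time n, named so that
    [g_sigma_algebraType] can turn the filtration into a measurable type. *)
Definition history (n : nat) : set (set T) :=
  [set B : set T | exists (m : nat) (j : 'I_k), (m <= n)%N /\
        preimage_set_system setT (fun w => U m w 0 j)
          (measurable : set (set R)) B].

Lemma history_measurable n : <<s history n>> `<=` measurable.
Proof.
apply: smallest_sub; first exact: sigma_algebra_measurable.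
move=> _ [m [j [_ [B mB <-]]]]; exact: (urn_measurable urn).
Qed.

Lemma urn_finite_range m j : finite_set (range (fun w => U m w 0 j)).
Proof.
elim: m => [|m IH].
  rewrite (_ : (fun w => _) = cst (u0 0 j)); first exact: finite_image_cst.
  by apply/funext => w; rewrite (urn_init urn).
rewrite (_ : (fun w => _) = fun w => U m w 0 j + A (Z m w) j); last first.
  by apply/funext => w; rewrite urn_stepE.
apply: (finite_image11 +%R) => //.
have : finite_set (range (fun i : 'I_k => A i j)) by apply: finite_image; exact: finite_finset.
by apply: sub_finite_set => _ [w _ <-]; exists (Z m w).
Qed.

Lemma urn_sfun_history n m j : (m <= n)%N ->
  (fun w => U m w 0 j) \in @sfun _ (g_sigma_algebraType (history n)) R.
Proof.
move=> mn; apply/mem_sfunP; split; last exact: urn_finite_range.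
move=> _ B mB; apply: sub_sigma_algebra.
by exists m, j; split => //; exists B.
Qed.

Lemma urn_sfun m j : (fun w => U m w 0 j) \in @sfun _ T R.
Proof.
by apply/mem_sfunP; split; [exact: (urn_measurable urn)|exact: urn_finite_range].
Qed.

Definition draw_prob n i w : R :=
  (k%:R * theta - 1)^-1 * (theta - U n w 0 i / n.+1%:R).

Lemma draw_prob_sfun_history n m i : (m <= n)%N ->
  draw_prob m i \in @sfun _ (g_sigma_algebraType (history n)) R.
Proof.
move=> mn; apply: mem_sfunM; first exact: mem_sfun_cst.
apply: mem_sfunB; first exact: mem_sfun_cst.
by apply: mem_sfunM; [exact: urn_sfun_history|exact: mem_sfun_cst].
Qed.

Lemma draw_prob_sfun n i : draw_prob n i \in @sfun _ T R.
Proof.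
apply: mem_sfunM; first exact: mem_sfun_cst.
apply: mem_sfunB; first exact: mem_sfun_cst.
by apply: mem_sfunM; [exact: urn_sfun|exact: mem_sfun_cst].
Qed.

Definition noise j n w : R :=
  \sum_i (\1_[set w | Z n w = i] w - draw_prob n i w) * A i j.

Lemma noise_sfun j n : noise j n \in @sfun _ T R.
Proof.
apply: mem_sfun_sum => i; apply: mem_sfunM; last exact: mem_sfun_cst.
apply: mem_sfunB; last exact: draw_prob_sfun.
exact/mem_sfun_indic/(urn_colour_measurable urn).
Qed.

Lemma draw_sum n w j : \sum_i \1_[set w | Z n w = i] w * A i j = A (Z n w) j.
Proof.
rewrite (bigD1 (Z n w))//= indicE mem_set// mul1r big1 ?addr0// => i /eqP iZ.
by rewrite indicE memNset ?mul0r// => /= /esym.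
Qed.

Lemma noise_sumE n w j :
  \sum_(m < n) noise j m w =
  U n w 0 j - U 0%N w 0 j - \sum_(m < n) \sum_i draw_prob m i w * A i j.
Proof.
elim: n => [|n IH]; first by rewrite !big_ord0 !subrr.
rewrite !big_ord_recr/= IH urn_stepE /noise.
under [X in _ + X = _]eq_bigr do rewrite mulrBl.
rewrite sumrB draw_sum; ring.
Qed.

(** A single indicator of a colour need not be determined by the urn contents
    (two rows of A may coincide), but the noise sum is, because the draws enter
    it only through U. *)
Lemma noise_sum_sfun_history n j :
  (fun w => \sum_(m < n) noise j m w)
    \in @sfun _ (g_sigma_algebraType (history n)) R.
Proof.
under eq_fun do rewrite noise_sumE.
apply: mem_sfunB; first by apply: mem_sfunB; exact: urn_sfun_history.
apply: mem_sfun_sum => m; apply: mem_sfun_sum => i; apply: mem_sfunM.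
  exact/draw_prob_sfun_history/ltnW.
exact: mem_sfun_cst.
Qed.

Lemma noise_orthogonal n j a :
  \int[P]_w ((\sum_(m < n) noise j m w) ^+ a * noise j n w) = 0.
Proof.
pose Y w := (\sum_(m < n) noise j m w) ^+ a.
have hY : Y \in @sfun _ (g_sigma_algebraType (history n)) R.
  by apply: mem_sfunX; exact: noise_sum_sfun_history.
have hY' : Y \in @sfun _ T R.
  by apply: mem_sfunX; apply: mem_sfun_sum => m; exact: noise_sfun.
have hi i : (fun w => Y w * (\1_[set w | Z n w = i] w - draw_prob n i w)) \in sfun.
  apply: mem_sfunM => //; apply: mem_sfunB; last exact: draw_prob_sfun.
  exact/mem_sfun_indic/(urn_colour_measurable urn).
transitivity (\int[P]_w \sum_i
    A i j * (Y w * (\1_[set w | Z n w = i] w - draw_prob n i w))).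
  apply: eq_Rintegral => w _; rewrite -/(Y w) /noise mulr_sumr.
  by apply: eq_bigr => i _; rewrite [RHS]mulrC mulrA.
rewrite Rint_sfun_sum; last first.
  by move=> i; apply: mem_sfunM => //; exact: mem_sfun_cst.
apply: big1 => i _; rewrite Rint_sfunZ//.
rewrite (cond_prob_orthogonal (history_measurable (n := n)) _ (urn_colour_law urn n i)) ?mulr0//.
- exact: (urn_colour_measurable urn).
- exact: draw_prob_sfun.
Qed.

Hypotheses (hk : (2 <= k)%N) (htheta : 1 <= theta).

Lemma noise_bounded j n w : `|noise j n w| <= k%:R * (theta + 2).
Proof.
rewrite mulr_natl -[k in _ *+ k]card_ord -sumr_const.
have c1 := urn_scale_ge1 hk htheta.
apply: le_trans (ler_norm_sum _ _ _) _; apply: ler_sum => i _.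
rewrite normrM.
have A01 : `|A i j| <= 1.
  case: hA => A0 A1; rewrite ger0_norm// -(A1 i) (bigD1 j)//= lerDl.
  exact: sumr_ge0.
have p_le : `|draw_prob n i w| <= theta + 1.
  rewrite /draw_prob normrM ger0_norm ?invr_ge0 ?(le_trans ler01)//.
  have V0 : 0 <= U n w 0 i / n.+1%:R by rewrite divr_ge0// urn_ge0.
  have V1 : U n w 0 i / n.+1%:R <= 1.
    by rewrite ler_pdivrMr ?ltr0n// mul1r urn_le.
  apply: (@le_trans _ _ (1 * `|theta - U n w 0 i / n.+1%:R|)).
    by rewrite ler_wpM2r// invf_le1// (lt_le_trans ltr01).
  rewrite mul1r ler_norml; move: (U n w 0 i / _) V0 V1 => v v0 v1.
  by apply/andP; split; move: htheta; lra.
have i_le : `|\1_[set w | Z n w = i] w : R| <= 1.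
  by rewrite indicE; case: (_ \in _); rewrite ?normr1 ?normr0.
rewrite -[leRHS]mulr1; apply: ler_pM => //.
apply: le_trans (ler_normB _ _) _; lra.
Qed.

Lemma noise_strong_law :
  {ae P, forall w, forall j,
    (fun n => (\sum_(m < n) noise j m w) / n.+1%:R) @ \oo --> 0}.
Proof.
apply: filter_forall => j.
apply: (martingale_strong_law (noise_sfun j) (noise_bounded j)) => n a.
exact: noise_orthogonal.
Qed.

End UrnPath.

Theorem theorem1 (R : realType) (k : nat) (theta : R) (A : 'M[R]_k)
    (hk : (2 <= k)%N) (htheta : 1 <= theta) (hA : stochastic_mx A)
    (hirr : irreducible_mx (hat_mx theta A)) :
  exists mu : 'rV[R]_k,
    [/\ urn_eq theta A mu,
        forall nu : 'rV[R]_k, urn_eq theta A nu -> nu = mu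
      & forall (d : measure_display) (T : measurableType d)
          (P : probability T R) (u0 : 'rV[R]_k)
          (U : nat -> T -> 'rV[R]_k) (Z : nat -> T -> 'I_k),
          prob_vector u0 ->
          neg_urn_scheme P theta A u0 U Z ->
          {ae P, forall w, forall j : 'I_k,
            (fun n : nat => U n w 0 j / n.+1%:R) @ \oo --> mu 0 j}].
Proof.
have unitM := urn_eq_unit hk htheta hA hirr.
set M := _%:M + A in unitM.
pose mu : 'rV[R]_k := (theta *: const_mx 1) *m A *m invmx M.
have hmu : urn_eq theta A mu by apply/urn_eq_mulmx; rewrite mulmxKV.
exists mu; split=> // [nu /urn_eq_mulmx hnu|d T P u0 U Z hu0 urn].
  by rewrite /mu -hnu mulmxK.
apply: filterS (noise_strong_law hu0 hA urn hk htheta) => w noise0.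
apply: (urn_path_cvg hk htheta hA hirr hmu) => [n|j].
  exact: urn_sum hu0 hA urn n w.
rewrite (_ : (fun n => _) =
  fun n => (\sum_(m < n) noise theta A U Z j m w) / n.+1%:R)//.
apply/funext => n; rewrite (noise_sumE urn) !mxE; congr ((_ - _ - _) / _).
rewrite summxE; apply: eq_bigr => m _.
rewrite !mxE mulr_sumr; apply: eq_bigr => i _.
by rewrite !mxE mulr1 /draw_prob mulrA [_^-1 * U _ _ _ _]mulrC.
Qed.
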